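(* Let $N\ge 3$ and let $K$ and $K'$ be general representations (of given dimension vectors) of the $N$-arrowed Kronecker quiver, and assume that one of them is semistable. Then at most one of the groups $\mathrm{Ext}^i(K',K)$ is nonzero.
   Context: Work over $\mathbb C$. Let $U$ be a vector space of dimension $N$. A representation of the $N$-arrowed Kronecker quiver (a Kronecker $U$-module) of dimension vector $(b,a)$ is a linear map $e:\mathbb C^b\to\mathbb C^a\otimes U^*$, i.e. an $a\times b$ matrix with entries in $U^*$. A homomorphism from $f:\mathbb C^{b'}\to\mathbb C^{a'}\otimes U^*$ to $e$ is a pair of linear maps $\beta:\mathbb C^{b'}\to\mathbb C^b$, $\alpha:\mathbb C^{a'}\to\mathbb C^a$ with $e\circ\beta=(\alpha\otimes\mathrm{id})\circ f$. These modules form an abelian category with $\mathrm{Ext}^i=0$ for $i>1$. The slope of a nonzero module of dimension vector $(b,a)$ is $b/a$ ($=\infty$ if $a=0$, $b>0$); a module $e$ is semistable if every nonzero submodule $f\subset e$ has slope at most that of $e$. ''General representations'' means that, with the two dimension vectors fixed, the statement holds for all pairs in a dense open subset of the product of the two affine spaces of matrices; the hypothesis is that for at least one of the two dimension vectors the general representation is semistable. *)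

(* Defs.v *)
From HB Require Import structures.
From mathcomp Require Import all_boot all_order all_algebra.
From mathcomp Require Import constructive_ereal reals complex.
(* Not imported: its notations are incompatible with those of reals. *)
From mathcomp Require mpoly.
Set Implicit Arguments.
Unset Strict Implicit.
Unset Printing Implicit Defensive.
Import Order.TTheory GRing.Theory Num.Theory.
Local Open Scope ring_scope.

Section Zariski.
Variables (F : fieldType) (V : vectType F).

(* Polynomial functions in the coordinates with respect to the library's basis
   of V; any other basis gives the same topology. *)
Definition poly_eval (p : mpoly.mpoly (\dim {:V}) F) (v : V) : F :=
  mpoly.meval (fun i => coord (vbasis {:V}) i v) p.

(* The complement of the common zero locus of a set E of polynomials. *)
Definition zariski_open (S : V -> Prop) : Prop :=
  exists E : mpoly.mpoly (\dim {:V}) F -> Prop,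
    forall v, S v <-> exists2 p, E p & poly_eval p v != 0.

Definition zariski_dense (S : V -> Prop) : Prop :=
  forall T : V -> Prop,
    zariski_open T -> (exists v, T v) -> exists v, T v /\ S v.

Definition holds_generally (P : V -> Prop) : Prop :=
  exists S : V -> Prop,
    [/\ zariski_open S, zariski_dense S & forall v, S v -> P v].

End Zariski.

Section Kronecker.
Variables (F : fieldType) (U : vectType F).

(* An a x b matrix with entries in the dual of U is the same thing as a linear
   map from U to a x b matrices: e u is the matrix e with every entry evaluated
   at u. Matrices act on column vectors, so e maps F^b to F^a (x) U^*. *)
Definition krep (b a : nat) : vectType F := 'Hom(U, 'M[F]_(a, b)).

Record kmod := KMod { kb : nat; ka : nat; kmx : 'Hom(U, 'M[F]_(ka, kb)) }.

Definition kmod_of (b a : nat) (e : krep b a) : kmod := @KMod b a e.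

(* Pairs (beta, alpha) of linear maps, not required to be a homomorphism. *)
Definition kpair (M N : kmod) : Type :=
  ('M[F]_(kb N, kb M) * 'M[F]_(ka N, ka M))%type.

Definition kpair0 (M N : kmod) : kpair M N := (0, 0).

Definition kcomp (M N P : kmod) (psi : kpair N P) (phi : kpair M N) :
  kpair M P := (psi.1 *m phi.1, psi.2 *m phi.2).

(* e o beta = (alpha (x) id) o f, evaluated at each u in U. *)
Definition is_khom (M N : kmod) (phi : kpair M N) : Prop :=
  forall u : U, kmx N u *m phi.1 = phi.2 *m kmx M u.

(* row_full and row_free refer to the action on row vectors; for the action on
   columns used here they mean injective and surjective respectively. *)
Definition kinj (M N : kmod) (phi : kpair M N) : Prop :=
  row_full phi.1 /\ row_full phi.2.

Definition ksurj (M N : kmod) (phi : kpair M N) : Prop :=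
  row_free phi.1 /\ row_free phi.2.

Definition kexact (M N P : kmod) (phi : kpair M N) (psi : kpair N P) : Prop :=
  (forall v : 'cV[F]_(kb N),
     psi.1 *m v = 0 <-> exists w : 'cV[F]_(kb M), v = phi.1 *m w) /\
  (forall v : 'cV[F]_(ka N),
     psi.2 *m v = 0 <-> exists w : 'cV[F]_(ka M), v = phi.2 *m w).

Definition knonzero (M : kmod) : Prop := (0 < kb M)%N \/ (0 < ka M)%N.

(* Only meaningful for nonzero modules. *)
Definition slope (M : kmod) : \bar rat :=
  if ka M == 0%N then +oo%E else ((kb M)%:R / (ka M)%:R)%:E.

Definition semistable (M : kmod) : Prop :=
  forall (S : kmod) (iota : kpair S M),
    is_khom iota -> kinj iota -> knonzero S -> (slope S <= slope M)%E.

Definition projective (P : kmod) : Prop :=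
  forall (M N : kmod) (p : kpair M N) (g : kpair P N),
    is_khom p -> ksurj p -> is_khom g ->
    exists2 h : kpair P M, is_khom h & kcomp p h = g.

Record proj_resolution (M : kmod) := ProjResolution {
  pr_obj : nat -> kmod;
  pr_d : forall i, kpair (pr_obj i.+1) (pr_obj i);
  pr_aug : kpair (pr_obj 0) M;
  pr_projective : forall i, projective (pr_obj i);
  pr_d_hom : forall i, is_khom (pr_d i);
  pr_aug_hom : is_khom pr_aug;
  pr_aug_surj : ksurj pr_aug;
  pr_exact0 : kexact (pr_d 0) pr_aug;
  pr_exactS : forall i, kexact (pr_d i.+1) (pr_d i) }.

(* Cocycles and coboundaries of the complex Hom(P_0, K) -> Hom(P_1, K) -> ... *)
Definition ext_cocycle (M K : kmod) (P : proj_resolution M) (i : nat)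
    (h : kpair (pr_obj P i) K) : Prop :=
  is_khom h /\ kcomp h (pr_d P i) = kpair0 _ _.

Definition ext_coboundary (M K : kmod) (P : proj_resolution M) (i : nat) :
    kpair (pr_obj P i) K -> Prop :=
  match i with
  | 0%N => fun h => h = kpair0 _ _
  | j.+1 => fun h =>
      exists2 g : kpair (pr_obj P j) K, is_khom g & h = kcomp g (pr_d P j)
  end.

(* Ext^i(M, K) <> 0, Ext^i being the derived functor of Hom(-, K); the
   cohomology does not depend on the projective resolution P of M. *)
Definition ext_nonzero (i : nat) (M K : kmod) : Prop :=
  exists (P : proj_resolution M) (h : kpair (pr_obj P i) K),
    ext_cocycle h /\ ~ ext_coboundary h.

End Kronecker.

(* Main.v *)
(** Write [nabla] for the linear map sending a pair [(beta, alpha)] of linear maps from [M]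
    to [N] to [N beta - alpha M]; its kernel is [Hom (M, N)], its cokernel is [Ext^1 (M, N)],
    and the higher Ext groups vanish.  Its rank is lower semicontinuous, so it suffices to
    find one pair [(M, N)] for which it is injective or surjective.  Take [M] (or [N]) in the
    open set of semistable modules, the rank of [nabla] maximal, and then [phi] in
    [Hom (M, N)] with the sum of its two ranks maximal; let [K], [I], [C] be its kernel, image
    and cokernel.  Along every line through [(M, N)], [phi] extends to a curve of
    homomorphisms, generically of no larger rank.  Comparing first-order terms gives
    [Hom (K, C) = 0], [Ext^1 (M, N) = Ext^1 (K, C)] and [Ext^1 (I, C) = Ext^1 (K, I) = 0].
    If [Ext^1 (M, N)] is nonzero, then the Euler form satisfies [chi (K, C) < 0],
    [0 <= chi (I, C)] and [0 <= chi (K, I)].  For nonzero [phi] this is incompatible with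
    [slope K <= slope M <= slope I] if [M] is semistable (by the first two inequalities), and
    with [slope I <= slope N <= slope C] if [N] is semistable (by the first and the third). *)
Require Import Defs.
From HB Require Import structures.
From mathcomp Require Import all_boot all_order all_algebra.
From mathcomp Require Import boolp constructive_ereal reals complex.
(* Not imported in full: its notations are incompatible with those of reals. *)
From mathcomp Require mpoly.
Import (canonicals) mpoly.
From mathcomp Require Import zify.
Set Implicit Arguments.
Unset Strict Implicit.
Unset Printing Implicit Defensive.
Import Order.TTheory GRing.Theory Num.Theory.
Local Open Scope ring_scope.

Lemma lfun_of_linear (F : fieldType) (aT rT : vectType F) (f : aT -> rT) :
  linear f -> {h : 'Hom(aT, rT) | forall u, h u = f u}.
Proof.
move=> lf.
pose f' := HB.pack_for {linear aT -> rT} f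
  (GRing.isLinear.Build F aT rT *:%R f lf).
by exists (linfun f') => u; rewrite lfunE.
Qed.

(** * Ext groups computed from projective resolutions *)

Section Ext.
Variables (F : fieldType) (U : vectType F).
Implicit Types (M N P K : kmod U).

Definition hom_trivial M N := forall phi : kpair M N, is_khom phi -> phi = kpair0 M N.

(** Such a [d] is the off-diagonal block of an extension of [M] by [N], and [x] is a splitting of
    it. *)
Definition ext1_trivial M N :=
  forall d : 'Hom(U, 'M[F]_(ka N, kb M)), exists x : kpair M N,
    forall u, d u = kmx N u *m x.1 - x.2 *m kmx M u.

(** The columns of [cokermx A] span the column kernel of [A], so the hypothesis puts the row space
    of [B] inside that of [A]. *)
Lemma col_factor m n p (A : 'M[F]_(m, n)) (B : 'M[F]_(p, n)) :
  (forall v : 'cV_n, A *m v = 0 -> B *m v = 0) -> B *m pinvmx A *m A = B.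
Proof.
move=> AB; apply: mulmxKpV; rewrite submxE; apply/eqP/matrixP => i j.
have /colP/(_ i) : B *m col j (cokermx A) = 0.
  by apply: AB; rewrite colE mulmxA mulmx_coker mul0mx.
by rewrite colE mulmxA -colE !mxE.
Qed.

Lemma cV_ext0 m n (A : 'M[F]_(m, n)) : (forall v : 'cV_n, A *m v = 0) -> A = 0.
Proof.
move=> A0; apply/matrixP => i j; have /colP/(_ i) := A0 (delta_mx j 0).
by rewrite -colE !mxE.
Qed.

(* A lift of the identity of [P] splits the extension of [P] by [K] with cocycle [d]. *)
Lemma projective_ext1_trivial P K : projective P -> ext1_trivial P K.
Proof.
move=> projP d.
have [|e eE] := @lfun_of_linear F U _
    (fun u => block_mx (kmx K u) (d u) 0 (kmx P u)).
  by move=> c u v; rewrite !linearP scale_block_mx add_block_mx scaler0 addr0.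
pose E := KMod e.
pose p : kpair E P := (row_mx 0 1%:M, row_mx 0 1%:M).
have hp : is_khom p.
  by move=> u; rewrite /= eE mul_mx_row mul_row_block !mulmx0 !mul0mx !mulmx1
    !mul1mx add0r add0r.
have sp : ksurj p.
  by split; apply/row_freeP; exists (col_mx 0 1%:M);
    rewrite mul_row_col mul0mx mul1mx add0r.
have hid : is_khom ((1%:M, 1%:M) : kpair P P) by move=> u; rewrite mulmx1 mul1mx.
have [[h1 h2] hh [h1E h2E]] := projP _ _ p _ hp sp hid.
exists (- usubmx h1, - usubmx h2) => u /=.
move: h1E h2E (hh u); rewrite /= -(vsubmxK h1) -(vsubmxK h2) !mul_row_col.
rewrite !mul0mx !mul1mx !add0r eE => -> ->; rewrite mul_block_col mul_col_mx !mulmx1 !mul1mx.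
by case/eq_col_mx => + _; rewrite !col_mxKu mulmxN mulNmx opprK => <-; rewrite addKr.
Qed.

(* Extend [h] along [d] linearly; the failure of the extension to be a homomorphism vanishes
   on the kernel of [p], hence comes from [T], where it can be corrected. *)
Lemma cocycle_lift Q'' Q' Q T K (d' : kpair Q'' Q') (d : kpair Q' Q)
    (p : kpair Q T) (h : kpair Q' K) :
  is_khom d -> is_khom p -> is_khom h -> kexact d' d -> kexact d p ->
  kcomp h d' = kpair0 _ _ -> ext1_trivial T K ->
  exists2 g : kpair Q K, is_khom g & h = kcomp g d.
Proof.
move=> hd hp hh [ex1' ex2'] [ex1 ex2] [hd1 hd2] extT.
have h1E : h.1 *m pinvmx d.1 *m d.1 = h.1.
  by apply: col_factor => v /ex1' [w ->]; rewrite mulmxA hd1 mul0mx.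
have h2E : h.2 *m pinvmx d.2 *m d.2 = h.2.
  by apply: col_factor => v /ex2' [w ->]; rewrite mulmxA hd2 mul0mx.
move: (h.1 *m pinvmx d.1) (h.2 *m pinvmx d.2) h1E h2E => g1 g2 h1E h2E.
pose defect u := kmx K u *m g1 - g2 *m kmx Q u.
have defectE u : defect u *m pinvmx p.1 *m p.1 = defect u.
  apply: col_factor => v /ex1 [w ->]; rewrite mulmxA mulmxBl -[X in X - _]mulmxA h1E.
  by rewrite -[g2 *m _ *m _]mulmxA hd mulmxA h2E hh subrr mul0mx.
have [|dl dlE] := @lfun_of_linear F U _ (fun u => defect u *m pinvmx p.1).
  move=> c u v; rewrite /defect (linearP (kmx K)) (linearP (kmx Q)) /=.
  rewrite [_ *m g1]mulmxDl [g2 *m _]mulmxDr -[_ *m g1]scalemxAl -[g2 *m (_ *: _)]scalemxAr.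
  by rewrite opprD addrACA -scalerBr [LHS]mulmxDl -scalemxAl.
have [x xE] := extT dl.
have pd1 : p.1 *m d.1 = 0.
  by apply: cV_ext0 => v; rewrite -mulmxA; apply/ex1; exists v.
have pd2 : p.2 *m d.2 = 0.
  by apply: cV_ext0 => v; rewrite -mulmxA; apply/ex2; exists v.
exists (g1 - x.1 *m p.1, g2 - x.2 *m p.2) => [u|] /=.
  have := defectE u; rewrite -dlE xE mulmxBl -[x.2 *m _ *m _]mulmxA hp !mulmxA.
  move/eqP; rewrite eq_sym subr_eq => /eqP defE; rewrite mulmxBr mulmxBl !mulmxA defE.
  by rewrite [X in X - _]addrC -addrA [_ - _ - _]addrAC subrr add0r.
by rewrite /kcomp /= !mulmxBl h1E h2E -!mulmxA pd1 pd2 !mulmx0 !subr0; case: (h).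
Qed.

(** A cocycle of degree 0 kills the kernel of the augmentation, so it descends to a homomorphism
    from [M] to [K]. *)
Lemma ext_nonzero0 M K : ext_nonzero 0 M K -> ~ hom_trivial M K.
Proof.
case=> P [h [[hh [hd1 hd2]] nh]] triv; apply: nh => /=.
have [ex1 ex2] := pr_exact0 P.
have h1E : h.1 *m pinvmx (pr_aug P).1 *m (pr_aug P).1 = h.1.
  by apply: col_factor => v /ex1 [w ->]; rewrite mulmxA hd1 mul0mx.
have h2E : h.2 *m pinvmx (pr_aug P).2 *m (pr_aug P).2 = h.2.
  by apply: col_factor => v /ex2 [w ->]; rewrite mulmxA hd2 mul0mx.
move: (h.1 *m pinvmx _) (h.2 *m pinvmx _) h1E h2E => g1 g2 h1E h2E.
have [g10 g20] : (g1, g2) = kpair0 M K.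
  apply: triv => u; have [free1 _] := pr_aug_surj P; apply: (row_free_inj free1) => /=.
  by rewrite -[LHS]mulmxA h1E -mulmxA (pr_aug_hom P) mulmxA h2E hh.
by case: (h) h1E h2E => h1 h2 /= <- <-; rewrite g10 g20 !mul0mx.
Qed.

(** In degree 1, [cocycle_lift] applies with [T] equal to [M]. In degree [i.+2] it applies with [T]
    equal to the [i]-th term of the resolution, whose projectivity makes every cocycle a
    coboundary. *)
Lemma ext_nonzeroS i M K : ext_nonzero i.+1 M K -> i = 0%N /\ ~ ext1_trivial M K.
Proof.
case=> P [h [[hh hd] nh]]; case: i h hh hd nh => [|i] h hh hd nh.
  split=> // triv; apply: nh.
  exact: (cocycle_lift (pr_d_hom P 0) (pr_aug_hom P) hh (pr_exactS P 0)
    (pr_exact0 P) hd triv).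
case: nh; have projP := @pr_projective _ _ _ P i.
exact: (cocycle_lift (pr_d_hom P i.+1) (pr_d_hom P i) hh (pr_exactS P i.+1)
  (pr_exactS P i) hd (projective_ext1_trivial (K := K) projP)).
Qed.

End Ext.

(** * Splittings of a matrix along kernel and image *)

(* A factorization of [phi] through its image, with a complement of its kernel in the source
   and of its image in the target; [L] and [R] mark left and right inverses. *)
Record splitting (F : fieldType) (m n r k c : nat) (phi : 'M[F]_(m, n)) := Splitting {
  sp_im : 'M[F]_(m, r); sp_imL : 'M[F]_(r, m);
  sp_coker : 'M[F]_(c, m); sp_cokerR : 'M[F]_(m, c);
  sp_coim : 'M[F]_(r, n); sp_coimR : 'M[F]_(n, r);
  sp_ker : 'M[F]_(n, k); sp_kerL : 'M[F]_(k, n);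
  sp_factor : phi = sp_im *m sp_coim;
  sp_imK : sp_imL *m sp_im = 1%:M;
  sp_cokerK : sp_coker *m sp_cokerR = 1%:M;
  sp_coker_im : sp_coker *m sp_im = 0;
  sp_im_coker : sp_im *m sp_imL + sp_cokerR *m sp_coker = 1%:M;
  sp_coimK : sp_coim *m sp_coimR = 1%:M;
  sp_kerK : sp_kerL *m sp_ker = 1%:M;
  sp_coim_ker : sp_coim *m sp_ker = 0;
  sp_coim_kerE : sp_coimR *m sp_coim + sp_ker *m sp_kerL = 1%:M;
  sp_dimN : m = (r + c)%N; sp_dimM : n = (r + k)%N }.

Section Splitting.
Variable F : fieldType.

(** Gaussian elimination writes [phi] as [L *m pid_mx r *m R] with [L] and [R] invertible; the data
    are the blocks of [L], [R] and their inverses. *)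
Lemma splitting_exists (m n : nat) (phi : 'M[F]_(m, n)) :
  exists k c, inhabited (splitting (\rank phi) k c phi).
Proof.
exists (n - \rank phi)%N, (m - \rank phi)%N.
move: (mulmx_ebase phi) (row_ebase_unit phi) (col_ebase_unit phi).
move: (rank_leq_row phi) (rank_leq_col phi).
move: (\rank phi) (row_ebase phi) (col_ebase phi) => r R L rm rn phiE Ru Lu.
have [k nE] : {k | n = (r + k)%N} by exists (n - r)%N; rewrite subnKC.
have [c mE] : {c | m = (r + c)%N} by exists (m - r)%N; rewrite subnKC.
subst n m; rewrite !addKn.
have [R1 R2] := (mulmxV Ru, mulVmx Ru); have [L1 L2] := (mulmxV Lu, mulVmx Lu).
move: (invmx R) (invmx L) R1 R2 L1 L2 => R' L' R1 R2 L1 L2.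
move: R1; rewrite -{1}(vsubmxK R) -{1}(hsubmxK R') mul_col_row scalar_mx_block.
case/eq_block_mx => R11 R12 R21 R22.
move: L2; rewrite -{1}(hsubmxK L) -{1}(vsubmxK L') mul_col_row scalar_mx_block.
case/eq_block_mx => L11 L12 L21 L22.
split; apply: (@Splitting _ _ _ _ _ _ _ (lsubmx L) (usubmx L') (dsubmx L')
  (rsubmx L) (usubmx R) (lsubmx R') (rsubmx R') (dsubmx R)) => //.
- rewrite -phiE -{1}(hsubmxK L) -{1}(vsubmxK R) pid_mx_block mul_row_block.
  by rewrite !mulmx0 !addr0 mulmx1 mul_row_col mul0mx addr0.
- by rewrite -mul_row_col hsubmxK vsubmxK.
- by rewrite -mul_row_col hsubmxK vsubmxK.
Qed.

Variables (m n r k c : nat) (phi : 'M[F]_(m, n)) (S : splitting r k c phi).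

Lemma sp_ker_eq0 : phi *m sp_ker S = 0.
Proof. by rewrite {1}(sp_factor S) -mulmxA sp_coim_ker mulmx0. Qed.

Lemma sp_coker_eq0 : sp_coker S *m phi = 0.
Proof. by rewrite {2}(sp_factor S) mulmxA sp_coker_im mul0mx. Qed.

Lemma sp_imE : sp_im S = phi *m sp_coimR S.
Proof. by rewrite {2}(sp_factor S) -mulmxA sp_coimK mulmx1. Qed.

Lemma sp_coimE : sp_coim S = sp_imL S *m phi.
Proof. by rewrite {3}(sp_factor S) mulmxA sp_imK mul1mx. Qed.

Lemma sp_core : sp_imL S *m phi *m sp_coimR S = 1%:M.
Proof. by rewrite -mulmxA -sp_imE sp_imK. Qed.

End Splitting.

(** * Polynomial curves of matrices and their ranks *)

(** The exceptional values are bounded by the zeros of a polynomial, so that determinants serve as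
    witnesses and conjunctions become products. *)
Definition almost_all (F : fieldType) (P : F -> Prop) :=
  exists2 q : {poly F}, q != 0 & forall t, q.[t] != 0 -> P t.

Section Curves.
Variable F : fieldType.

Lemma almost_allI (P Q : F -> Prop) :
  almost_all P -> almost_all Q -> almost_all (fun t => P t /\ Q t).
Proof.
move=> [p p0 pP] [q q0 qQ]; exists (p * q); first by rewrite mulf_neq0.
by move=> t; rewrite hornerM mulf_eq0 negb_or => /andP[/pP ? /qQ].
Qed.

Lemma almost_allW (P Q : F -> Prop) :
  (forall t, P t -> Q t) -> almost_all P -> almost_all Q.
Proof. by move=> PQ [p p0 pP]; exists p => // t /pP /PQ. Qed.

Definition mxeval m n (t : F) (X : 'M[{poly F}]_(m, n)) := map_mx (horner_eval t) X.
Definition mxcoef m n (i : nat) (X : 'M[{poly F}]_(m, n)) : 'M[F]_(m, n) :=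
  map_mx (coefp i) X.

Lemma mxeval0 m n (X : 'M[{poly F}]_(m, n)) : mxeval 0 X = mxcoef 0 X.
Proof. by apply/matrixP => i j; rewrite !mxE /horner_eval horner_coef0. Qed.

Lemma mxcoef0M m n p (X : 'M[{poly F}]_(m, n)) (Y : 'M_(n, p)) :
  mxcoef 0 (X *m Y) = mxcoef 0 X *m mxcoef 0 Y.
Proof. by rewrite -!mxeval0 /mxeval map_mxM. Qed.

Lemma mxcoef1M m n p (X : 'M[{poly F}]_(m, n)) (Y : 'M_(n, p)) :
  mxcoef 1 (X *m Y) = mxcoef 0 X *m mxcoef 1 Y + mxcoef 1 X *m mxcoef 0 Y.
Proof.
apply/matrixP => i j; rewrite !mxE /= coef_sum -big_split /=; apply: eq_bigr => l _.
by rewrite !mxE coefM !big_ord_recl big_ord0 addr0.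
Qed.

Definition mxconst m n (A : 'M[F]_(m, n)) : 'M[{poly F}]_(m, n) := map_mx polyC A.

Lemma mxeval_const m n t (A : 'M[F]_(m, n)) : mxeval t (mxconst A) = A.
Proof. by apply/matrixP => i j; rewrite !mxE /horner_eval hornerC. Qed.

Lemma mxcoef_const m n i (A : 'M[F]_(m, n)) : mxcoef i (mxconst A) = if i == 0%N then A else 0.
Proof. by apply/matrixP => k j; rewrite !mxE /= coefC; case: eqP => _; rewrite ?mxE. Qed.

Definition affine m n (A B : 'M[F]_(m, n)) : 'M[{poly F}]_(m, n) :=
  mxconst A + 'X *: mxconst B.

Lemma affine_coef0 m n (A B : 'M[F]_(m, n)) : mxcoef 0 (affine A B) = A.
Proof. by apply/matrixP => i j; rewrite !mxE /= coefD coefC coefXM addr0. Qed.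

Lemma affine_coef1 m n (A B : 'M[F]_(m, n)) : mxcoef 1 (affine A B) = B.
Proof. by apply/matrixP => i j; rewrite !mxE /= coefD coefXM !coefC add0r. Qed.

Lemma affine_eval m n t (A B : 'M[F]_(m, n)) : mxeval t (affine A B) = A + t *: B.
Proof.
apply/matrixP => i j.
by rewrite !mxE /= /horner_eval hornerD hornerM hornerX !hornerC.
Qed.

Lemma mxevalM m n p t (X : 'M[{poly F}]_(m, n)) (Y : 'M_(n, p)) :
  mxeval t (X *m Y) = mxeval t X *m mxeval t Y.
Proof. exact: map_mxM. Qed.

Lemma det_mxeval n t (X : 'M[{poly F}]_n) : \det (mxeval t X) = (\det X).[t].
Proof. by rewrite /mxeval det_map_mx. Qed.

(** At 0 the compressed matrix is the identity. Its determinant is thus a nonzero polynomial, and it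
    certifies rank at least [r] wherever it does not vanish. *)
Lemma det_core m n r k c (X : 'M[{poly F}]_(m, n))
    (S : splitting r k c (mxcoef 0 X)) :
  (\det (mxconst (sp_imL S) *m X *m mxconst (sp_coimR S))).[0] = 1.
Proof. by rewrite -det_mxeval mxeval0 !mxcoef0M !mxcoef_const /= sp_core det1. Qed.

Lemma poly_horner_neq0 (p : {poly F}) t : p.[t] != 0 -> p != 0.
Proof. by apply: contraNneq => ->; rewrite horner0. Qed.

Lemma unit_core_rank m n r (A : 'M[F]_(r, m)) (X : 'M_(m, n)) (B : 'M_(n, r)) :
  \det (A *m X *m B) != 0 -> (r <= \rank X)%N.
Proof.
rewrite -unitfE -unitmxE => /mxrank_unit rE.
apply: leq_trans (mxrankM_maxr A X).
by rewrite -{1}rE mxrankM_maxl.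
Qed.

Lemma rank_lower_semicontinuous m n r k c (X0 : 'M[F]_(m, n)) (X : 'M[{poly F}]_(m, n)) :
  splitting r k c X0 -> mxcoef 0 X = X0 -> almost_all (fun t => (r <= \rank (mxeval t X))%N).
Proof.
move=> S XE; subst X0; exists (\det (mxconst (sp_imL S) *m X *m mxconst (sp_coimR S))).
  by apply: (@poly_horner_neq0 _ 0); rewrite det_core oner_neq0.
by move=> t; rewrite -det_mxeval !mxevalM !mxeval_const => /unit_core_rank.
Qed.

(* In coordinates adapted to the splitting, the minor bordering the identity block by a row
   of the cokernel and a column of the kernel is [t] times a polynomial in [t] whose value
   at 0 is an entry of the matrix assumed nonzero. *)
Lemma rank_growth m n r k c (X0 : 'M[F]_(m, n)) (S : splitting r k c X0)
    (X : 'M[{poly F}]_(m, n)) :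
  mxcoef 0 X = X0 -> sp_coker S *m mxcoef 1 X *m sp_ker S != 0 ->
  almost_all (fun t => (r < \rank (mxeval t X))%N).
Proof.
move=> XE; subst X0; case/matrix0Pn => i [j nz].
pose A := col_mx (sp_imL S) (row i (sp_coker S)).
pose B := row_mx (sp_coimR S) (col j (sp_ker S)).
pose Y := mxconst A *m X *m mxconst B.
have Y0 : mxcoef 0 Y = block_mx 1%:M 0 0 0.
  rewrite !mxcoef0M !mxcoef_const /= mul_col_mx mul_col_row sp_core.
  rewrite -row_mul sp_coker_eq0 row0 mul0mx.
  by rewrite colE -mulmxA (mulmxA (mxcoef 0 X)) sp_ker_eq0 mul0mx mulmx0 mul0mx.
have Y1 : drsubmx (mxcoef 1 Y) = ((sp_coker S *m mxcoef 1 X *m sp_ker S) i j)%:M.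
  rewrite !mxcoef1M !mxcoef_const /= mulmx0 !mul0mx !add0r addr0.
  rewrite mul_col_mx mul_col_row block_mxKdr.
  apply/matrixP => u v; rewrite !ord1 -row_mul colE mulmxA -row_mul -colE.
  by rewrite mxE mxE [RHS]mxE eqxx.
pose Z := map_mx (drop_poly 1) (dsubmx Y).
have YE : Y = block_mx 1%:M 0 0 ('X)%:M *m col_mx (usubmx Y) Z.
  rewrite mul_block_col !mul0mx mul1mx addr0 add0r mul_scalar_mx -{1}(vsubmxK Y); congr col_mx.
  apply/matrixP => u v; rewrite [RHS]mxE [X in 'X * X]mxE.
  have Yuv0 : (dsubmx Y u v)`_0 = 0.
    have /matrixP/(_ (rshift r u) v) := Y0.
    by rewrite block_mxEv col_mxEd row_mx0 [LHS]mxE [RHS]mxE [dsubmx Y u v]mxE.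
  apply/polyP => l; rewrite coefXM coef_drop_poly.
  by case: l => [|l] //=; rewrite [(l + 1)%N]addn1.
exists (\det Y) => [|t].
  rewrite YE det_mulmx det_ublock det1 mul1r det_scalar1 mulf_neq0 ?polyX_eq0 //.
  apply: (@poly_horner_neq0 _ 0); rewrite -det_mxeval mxeval0.
  have -> : mxcoef 0 (col_mx (usubmx Y) Z) =
      block_mx 1%:M 0 (dlsubmx (mxcoef 1 Y)) (drsubmx (mxcoef 1 Y)).
    rewrite block_mxEv hsubmxK /mxcoef map_col_mx; congr col_mx.
      by rewrite map_usubmx -/(mxcoef 0 Y) Y0 block_mxEv col_mxKu.
    apply/matrixP => u v; rewrite [RHS]mxE [RHS]mxE [LHS]mxE [Z u v]mxE /=.
    by rewrite coef_drop_poly [dsubmx Y u v]mxE.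
  by rewrite det_lblock det1 mul1r Y1 det_scalar1.
rewrite -det_mxeval !mxevalM !mxeval_const => /unit_core_rank.
by rewrite addn1.
Qed.

Hypothesis F_infinite : forall p : {poly F}, p != 0 -> exists t, p.[t] != 0.

Lemma almost_all_ex (P : F -> Prop) : almost_all P -> exists t, P t.
Proof. by move=> [p /F_infinite [t pt] pP]; exists t; apply: pP. Qed.

Lemma almost_all_mx_eq0 m n (X : 'M[{poly F}]_(m, n)) :
  almost_all (fun t => mxeval t X = 0) -> X = 0.
Proof.
move=> [p p0 pX]; apply/matrixP => i j; rewrite [RHS]mxE; apply: contrapT => /eqP Xij.
have [t] := F_infinite (mulf_neq0 p0 Xij).
rewrite hornerM mulf_eq0 negb_or => /andP[/pX /matrixP/(_ i j)].
by rewrite !mxE /horner_eval => ->; rewrite eqxx.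
Qed.

(* Cramer's rule: [w := det (A D B) phi - (phi D B) adj (A D B) A] solves [w D B = 0],
   and [w D = 0] follows because [D B] and [D] have the same rank for almost all values of the parameter. *)
Lemma kernel_curve m n r k c (D0 : 'M[F]_(m, n)) (S : splitting r k c D0)
    (D : 'M[{poly F}]_(m, n)) (phi : 'rV[F]_m) :
  mxcoef 0 D = D0 -> almost_all (fun t => (\rank (mxeval t D) <= r)%N) -> phi *m D0 = 0 ->
  exists2 w : 'rV[{poly F}]_m, mxcoef 0 w = phi & w *m D = 0.
Proof.
move=> DE; subst D0; move=> Dr phiD.
pose A := mxconst (sp_imL S); pose B := mxconst (sp_coimR S).
pose E := A *m D *m B.
have detE : (\det E).[0] = 1 := det_core S.
pose w := \det E *: mxconst phi - mxconst phi *m D *m B *m \adj E *m A.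
have wDB : w *m (D *m B) = 0.
  rewrite mulmxBl -!mulmxA (mulmxA A) -/E mul_adj_mx mul_mx_scalar.
  by rewrite -scalemxAl -!scalemxAr subrr.
exists w.
  rewrite -mxeval0 /mxeval map_mxB map_mxZ -!/(mxeval 0 _) !mxevalM !mxeval_const.
  by rewrite mxeval0 phiD !mul0mx subr0 /= /horner_eval detE scale1r.
apply: almost_all_mx_eq0.
have : almost_all (fun t => \det (mxeval t E) != 0).
  exists (\det E) => [|t]; last by rewrite det_mxeval.
  by apply: (@poly_horner_neq0 _ 0); rewrite detE oner_neq0.
move=> /(almost_allI Dr); apply: almost_allW => t [Dt Et].
have rDB : \rank (mxeval t D) = \rank (mxeval t D *m sp_coimR S).
  apply/eqP; rewrite eqn_leq mxrankM_maxl andbT; apply: leq_trans Dt _.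
  apply: (@unit_core_rank _ _ _ (sp_imL S) _ 1%:M); rewrite mulmx1 mulmxA.
  by move: Et; rewrite !mxevalM !mxeval_const.
have ker : (kermx (mxeval t D *m sp_coimR S) <= kermx (mxeval t D))%MS.
  have le : (kermx (mxeval t D) <= kermx (mxeval t D *m sp_coimR S))%MS.
    by apply/sub_kermxP; rewrite mulmxA mulmx_ker mul0mx.
  by have [_ <-] := mxrank_leqif_sup le; rewrite !mxrank_ker -rDB.
rewrite mxevalM; apply/sub_kermxP; apply: submx_trans ker; apply/sub_kermxP.
by have := congr1 (mxeval t) wDB; rewrite !mxevalM mxeval_const => ->; apply: map_mx0.
Qed.

End Curves.

(** * The matrix of [nabla] and the Euler form *)

Section Nabla.
Import VectorInternalTheory.
Variables (F : fieldType) (U : vectType F).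

Fact sandwich_linear p q p' q' (A : 'M[F]_(p', p)) (X : 'Hom(U, 'M[F]_(p, q)))
  (B : 'M[F]_(q, q')) : linear (fun u => A *m X u *m B).
Proof. by move=> c u v; rewrite linearP mulmxDr mulmxDl -scalemxAr -scalemxAl. Qed.

Definition sandwich p q p' q' (A : 'M[F]_(p', p)) (X : 'Hom(U, 'M[F]_(p, q)))
    (B : 'M[F]_(q, q')) : 'Hom(U, 'M[F]_(p', q')) :=
  sval (lfun_of_linear (sandwich_linear A X B)).

Lemma sandwichE p q p' q' (A : 'M[F]_(p', p)) X (B : 'M[F]_(q, q')) u :
  sandwich A X B u = A *m X u *m B.
Proof. exact: (svalP (lfun_of_linear (sandwich_linear A X B))). Qed.

Variables b' a' b a : nat.
Implicit Types (f : krep U b' a') (e : krep U b a) (x : 'M[F]_(b, b') * 'M[F]_(a, a')).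

Definition nabla f e x : 'Hom(U, 'M[F]_(a, b')) :=
  sandwich 1%:M e x.1 - sandwich x.2 f 1%:M.

Lemma nablaE f e x u : nabla f e x u = e u *m x.1 - x.2 *m f u.
Proof. by rewrite !lfunE /= !lfunE /= !sandwichE mulmx1 mul1mx. Qed.

(** The ring is arbitrary because curves of pairs are rows of polynomials. *)
Definition unpack (R : nzRingType) (w : 'rV[R]_(b * b' + a * a')) : 'M_(b, b') * 'M_(a, a') :=
  (vec_mx (lsubmx w), vec_mx (rsubmx w)).

Definition pack (R : nzRingType) (x : 'M[R]_(b, b') * 'M_(a, a')) : 'rV[R]_(b * b' + a * a') :=
  row_mx (mxvec x.1) (mxvec x.2).

Lemma packK (R : nzRingType) : cancel (@pack R) (@unpack R).
Proof. by case=> x1 x2; rewrite /unpack row_mxKl row_mxKr !mxvecK. Qed.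

Lemma unpackK (R : nzRingType) : cancel (@unpack R) (@pack R).
Proof. by move=> w; rewrite /pack !vec_mxK hsubmxK. Qed.

Fact nabla_row_linear f e : linear (fun w => v2r (nabla f e (unpack w))).
Proof.
move=> c v w; rewrite -linearP /=; congr v2r; apply/lfunP => u.
rewrite [LHS]nablaE add_lfunE scale_lfunE !nablaE /=.
rewrite !(linearP lsubmx, linearP rsubmx, linearP vec_mx) /=.
by rewrite mulmxDr mulmxDl -scalemxAr -scalemxAl scalerBr opprD addrACA.
Qed.

Definition nablamx f e := lin1_mx (fun w => v2r (nabla f e (unpack w))).

Lemma mul_nablamx f e w : w *m nablamx f e = v2r (nabla f e (unpack w)).
Proof.
pose h := HB.pack_for {linear 'rV[F]_(b * b' + a * a') -> 'rV[F]_(dim 'Hom(U, 'M[F]_(a, b')))}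
  (fun w => v2r (nabla f e (unpack w)))
  (GRing.isLinear.Build F _ _ *:%R _ (nabla_row_linear f e)).
exact: (mul_rV_lin1 h).
Qed.

(** Hence [nablamx] is affine in the parameter along a line of pairs of modules, and its minors are
    polynomial functions of the pair. *)
Lemma nablamx_linear c f f1 e e1 :
  nablamx (c *: f + f1) (c *: e + e1) = c *: nablamx f e + nablamx f1 e1.
Proof.
apply/row_matrixP => i; rewrite !rowE mulmxDr -scalemxAr !mul_nablamx -linearP /=.
congr v2r; apply/lfunP => u; rewrite [LHS]nablaE [RHS]add_lfunE.
rewrite [X in _ = X + _]scale_lfunE !nablaE !add_lfunE !scale_lfunE.
by rewrite mulmxDr mulmxDl -scalemxAr -scalemxAl scalerBr opprD addrACA.
Qed.

Lemma nablamx_add_eq0 f f1 e e1 x x1 :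
  pack x *m nablamx f e + pack x1 *m nablamx f1 e1 = 0 ->
  forall u, nabla f e x u = - nabla f1 e1 x1 u.
Proof.
rewrite !mul_nablamx !packK -linearD -(linear0 v2r) => /v2r_inj /eqP.
by rewrite addr_eq0 => /eqP -> u; rewrite opp_lfunE.
Qed.

Lemma is_khomP f e (x : kpair (kmod_of f) (kmod_of e)) :
  is_khom x <-> pack x *m nablamx f e = 0.
Proof.
rewrite mul_nablamx packK; split=> [hx|hx u].
  have -> : nabla f e x = 0 by apply/lfunP => u; rewrite nablaE lfunE /= hx subrr.
  by rewrite linear0.
have nx : nabla f e x = 0 by apply: v2r_inj; rewrite linear0.
by apply/eqP; rewrite -subr_eq0 -nablaE nx lfunE.
Qed.

Lemma hom_trivialP f e : hom_trivial (kmod_of f) (kmod_of e) <-> row_free (nablamx f e).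
Proof.
split=> [triv|free x /is_khomP hx].
  rewrite -kermx_eq0; apply/rowV0P => w /sub_kermxP hw.
  have hx : is_khom (unpack w : kpair (kmod_of f) (kmod_of e)).
    by apply/is_khomP; rewrite unpackK.
  by rewrite -[w]unpackK (triv _ hx) /pack /= !linear0 row_mx0.
rewrite -[x]packK; have -> : pack x = 0.
  by apply: (row_free_inj free); rewrite /= mul0mx.
by rewrite /unpack !linear0.
Qed.

Lemma ext1_trivialP f e : ext1_trivial (kmod_of f) (kmod_of e) <-> row_full (nablamx f e).
Proof.
split=> [triv|/row_fullP[Z ZE] d].
  rewrite -sub1mx; apply/row_subP => i.
  have [x xE] := triv (r2v (row i 1%:M)).
  apply/submxP; exists (pack x); rewrite mul_nablamx packK -[LHS]r2vK; congr v2r.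
  by apply/lfunP => u; rewrite nablaE xE.
exists (unpack (v2r d *m Z)) => u.
rewrite -nablaE; congr (fun_of_lfun _ u); apply: v2r_inj.
by rewrite -mul_nablamx -mulmxA ZE mulmx1.
Qed.

(** The right side minus the left side is the Euler form, the dimension of Hom minus that of Ext^1.
    The next lemma is the case where it is negative. *)
Lemma ext1_trivial_dim f e : ext1_trivial (kmod_of f) (kmod_of e) ->
  (\dim {:U} * (a * b') <= b * b' + a * a')%N.
Proof.
move=> /ext1_trivialP /eqP full; rewrite dimvf -[X in (X <= _)%N]full.
exact: rank_leq_row.
Qed.

Lemma ext1_nontrivial_dim f e : hom_trivial (kmod_of f) (kmod_of e) ->
  ~ ext1_trivial (kmod_of f) (kmod_of e) -> (b * b' + a * a' < \dim {:U} * (a * b'))%N.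
Proof.
move=> /hom_trivialP free /ext1_trivialP full; rewrite ltnNge; apply/negP => le; apply: full.
rewrite /row_full eqn_leq rank_leq_col /= (eqP free).
by rewrite dimvf in le.
Qed.

End Nabla.

(** An infinite slope of [M] forces one of [N], and then both products vanish; if only [N] has
    infinite slope, the left side is 0. *)
Lemma slope_cross (F : fieldType) (U : vectType F) (M N : kmod U) :
  (slope M <= slope N)%E -> (kb M * ka N <= kb N * ka M)%N.
Proof.
rewrite /slope; case: eqVneq => [->|aM]; case: eqVneq => [->|aN] //; rewrite ?muln0 //.
rewrite lee_fin ler_pdivrMr ?ltr0n ?lt0n // mulrAC ler_pdivlMr ?ltr0n ?lt0n //.
by rewrite -!natrM ler_nat.
Qed.

(** * Kernel, image and cokernel of a homomorphism of maximal rank *)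

Section KernelImageCokernel.
Variables (F : fieldType) (U : vectType F) (b' a' b a : nat).
Variables (f : krep U b' a') (e : krep U b a).
Variables (phi : kpair (kmod_of f) (kmod_of e)) (hphi : is_khom phi).
Variables (r1 k1 c1 r2 k2 c2 : nat).
Variables (S1 : splitting r1 k1 c1 phi.1) (S2 : splitting r2 k2 c2 phi.2).

(** These are compressions of [f] and [e]; the four intertwining identities below show that they are
    the kernel, image and cokernel of [phi]. *)
Definition kker : krep U k1 k2 := sandwich (sp_kerL S2) f (sp_ker S1).
Definition kim : krep U r1 r2 := sandwich (sp_coim S2) f (sp_coimR S1).
Definition kcoker : krep U c1 c2 := sandwich (sp_coker S2) e (sp_cokerR S1).

Let hphiE u : e u *m phi.1 = phi.2 *m f u := hphi u.

Lemma kker_incl u : f u *m sp_ker S1 = sp_ker S2 *m kker u.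
Proof.
rewrite sandwichE !mulmxA -[LHS]mul1mx -(sp_coim_kerE S2) mulmxDl -!mulmxA (sp_coimE S2).
by rewrite -!mulmxA (mulmxA phi.2) -hphiE -mulmxA sp_ker_eq0 !mulmx0 add0r.
Qed.

Lemma kim_incl u : e u *m sp_im S1 = sp_im S2 *m kim u.
Proof. by rewrite sandwichE !mulmxA -(sp_factor S2) -hphiE -mulmxA -sp_imE. Qed.

Lemma kim_proj u : sp_coim S2 *m f u = kim u *m sp_coim S1.
Proof.
rewrite sandwichE -[RHS]mulmxA -[LHS]mulmx1 -(sp_coim_kerE S1) mulmxDr !mulmxA.
by rewrite -[_ *m f u *m sp_ker S1]mulmxA kker_incl mulmxA sp_coim_ker !mul0mx addr0.
Qed.

Lemma kcoker_proj u : sp_coker S2 *m e u = kcoker u *m sp_coker S1.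
Proof.
rewrite sandwichE -[RHS]mulmxA -[LHS]mulmx1 -(sp_im_coker S1) mulmxDr !mulmxA.
by rewrite -[_ *m e u *m sp_im S1]mulmxA kim_incl mulmxA sp_coker_im !mul0mx add0r.
Qed.

(** The dimension vector of [f] is the sum of those of kernel and image, so cancelling [k1 * k2]
    turns a comparison of the kernel with [f] into one with the image. *)
Lemma semistable_kker_slope : semistable (kmod_of f) -> (0 < k1)%N ->
  (k1 * r2 <= r1 * k2)%N.
Proof.
move=> ss k1_gt0.
have : (slope (kmod_of kker) <= slope (kmod_of f))%E.
  apply: (ss (kmod_of kker) (sp_ker S1, sp_ker S2)) => [u||]; first exact: kker_incl.
    by split; apply/row_fullP; [exists (sp_kerL S1) | exists (sp_kerL S2)];
    rewrite sp_kerK.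
  by left.
move=> /slope_cross /=; have /= -> := sp_dimM S1; have /= -> := sp_dimM S2.
by rewrite mulnDr mulnDl leq_add2r.
Qed.

Lemma semistable_kim_slope : semistable (kmod_of e) -> (0 < r1)%N || (0 < r2)%N ->
  (r1 * c2 <= c1 * r2)%N.
Proof.
move=> ss r_gt0.
have : (slope (kmod_of kim) <= slope (kmod_of e))%E.
  apply: (ss (kmod_of kim) (sp_im S1, sp_im S2)) => [u||]; first exact: kim_incl.
    by split; apply/row_fullP; [exists (sp_imL S1) | exists (sp_imL S2)];
    rewrite sp_imK.
  exact/orP.
move=> /slope_cross /=; have /= -> := sp_dimN S1; have /= -> := sp_dimN S2.
by rewrite mulnDr mulnDl leq_add2l.
Qed.

(** The vanishing of [sp_coker *m y *m sp_ker] says that [y] maps the kernel of [phi] into its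
    image. Both hypotheses are first-order consequences of maximality, proved later in
    [maximal_homs] and [maximal_lift]. *)
Hypothesis homs_kker_im : forall psi : kpair (kmod_of f) (kmod_of e), is_khom psi ->
  sp_coker S1 *m psi.1 *m sp_ker S1 = 0 /\ sp_coker S2 *m psi.2 *m sp_ker S2 = 0.

Hypothesis lift_kker_im : forall d : 'Hom(U, 'M[F]_(a, b')),
  (forall u, sp_coker S2 *m d u *m sp_ker S1 = 0) ->
  exists y : kpair (kmod_of f) (kmod_of e),
    [/\ forall u, d u = e u *m y.1 - y.2 *m f u,
        sp_coker S1 *m y.1 *m sp_ker S1 = 0 & sp_coker S2 *m y.2 *m sp_ker S2 = 0].

(** The lift is zero on the complement of the kernel and has values in the complement of the image;
    it need not be a homomorphism. *)
Let extend (th : kpair (kmod_of kker) (kmod_of kcoker)) : kpair (kmod_of f) (kmod_of e) :=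
  (sp_cokerR S1 *m th.1 *m sp_kerL S1, sp_cokerR S2 *m th.2 *m sp_kerL S2).

Let extend_defect th u :
  sp_coker S2 *m (e u *m (extend th).1 - (extend th).2 *m f u) *m sp_ker S1 =
  kcoker u *m th.1 - th.2 *m kker u.
Proof.
rewrite mulmxBr mulmxBl /=; congr (_ - _).
  rewrite !mulmxA kcoker_proj -!mulmxA (mulmxA (sp_coker S1)) sp_cokerK mul1mx.
  by rewrite sp_kerK mulmx1.
rewrite -!mulmxA kker_incl (mulmxA (sp_coker S2)) sp_cokerK mul1mx.
by rewrite (mulmxA (sp_kerL S2)) sp_kerK mul1mx.
Qed.

(** The defect of [extend th] induces zero from kernel to cokernel, so a pair [y] mapping kernel
    into image corrects it. The corrected pair is a homomorphism that still induces [th], which must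
    then vanish. *)
Lemma hom_kker_kcoker : hom_trivial (kmod_of kker) (kmod_of kcoker).
Proof.
move=> th hth.
have [u|y [yE y1 y2]] := @lift_kker_im (nabla f e (extend th)).
  by rewrite nablaE extend_defect hth subrr.
have [|h1 h2] := homs_kker_im (psi := ((extend th).1 - y.1, (extend th).2 - y.2)).
  move=> u; have := yE u; rewrite nablaE => /eqP; rewrite subr_eq => /eqP defE.
  by rewrite /= mulmxBr mulmxBl defE addrAC [_ - _ - _]addrAC subrr add0r addrC.
have th1 : th.1 = 0.
  move: h1; rewrite /= mulmxBr mulmxBl y1 subr0 !mulmxA sp_cokerK mul1mx.
  by rewrite -mulmxA sp_kerK mulmx1.
have th2 : th.2 = 0.
  move: h2; rewrite /= mulmxBr mulmxBl y2 subr0 !mulmxA sp_cokerK mul1mx.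
  by rewrite -mulmxA sp_kerK mulmx1.
by rewrite [th]surjective_pairing th1 th2.
Qed.

(** After a solution of the induced equation is lifted by [extend], the remainder induces zero from
    kernel to cokernel and is covered by [lift_kker_im]. *)
Lemma ext1_kker_kcoker : ext1_trivial (kmod_of kker) (kmod_of kcoker) ->
  ext1_trivial (kmod_of f) (kmod_of e).
Proof.
move=> triv d.
have [th thE] := triv (sandwich (sp_coker S2) d (sp_ker S1)).
have [u|y [yE _ _]] := @lift_kker_im (d - nabla f e (extend th)).
  rewrite add_lfunE opp_lfunE nablaE mulmxBr mulmxBl extend_defect -thE.
  by rewrite sandwichE subrr.
exists ((extend th).1 + y.1, (extend th).2 + y.2) => u.
move: (yE u); rewrite add_lfunE opp_lfunE nablaE.
move/eqP; rewrite subr_eq => /eqP -> /=.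
by rewrite mulmxDr mulmxDl opprD addrC addrACA.
Qed.

Lemma ext1_kim_kcoker : ext1_trivial (kmod_of kim) (kmod_of kcoker).
Proof.
move=> d.
have [u|y [yE y1 y2]] := @lift_kker_im (sandwich (sp_cokerR S2) d (sp_coim S1)).
  by rewrite sandwichE !mulmxA sp_cokerK mul1mx -mulmxA sp_coim_ker mulmx0.
exists (sp_coker S1 *m y.1 *m sp_coimR S1, sp_coker S2 *m y.2 *m sp_coimR S2) => u.
have := congr1 (fun X => sp_coker S2 *m X *m sp_coimR S1) (yE u).
rewrite sandwichE !mulmxA sp_cokerK mul1mx -mulmxA sp_coimK mulmx1 => ->.
rewrite mulmxBr mulmxBl !mulmxA kcoker_proj; congr (_ - _).
(* Since [y.2] maps kernel into image, its composite with the cokernel projection factors through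
   the projection to the image of [phi]. *)
have defy : sp_coker S2 *m y.2 = sp_coker S2 *m y.2 *m sp_coimR S2 *m sp_coim S2.
  by rewrite -[LHS]mulmx1 -(sp_coim_kerE S2) mulmxDr !mulmxA y2 mul0mx addr0.
rewrite [in LHS]defy -!mulmxA (mulmxA (sp_coim S2)) kim_proj.
by rewrite -(mulmxA (kim u)) sp_coimK mulmx1.
Qed.

Lemma ext1_kker_kim : ext1_trivial (kmod_of kker) (kmod_of kim).
Proof.
move=> d.
have [u|y [yE y1 y2]] := @lift_kker_im (sandwich (sp_im S2) d (sp_kerL S1)).
  by rewrite sandwichE !mulmxA sp_coker_im !mul0mx.
exists (sp_imL S1 *m y.1 *m sp_ker S1, sp_imL S2 *m y.2 *m sp_ker S2) => u.
have := congr1 (fun X => sp_imL S2 *m X *m sp_ker S1) (yE u).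
rewrite sandwichE !mulmxA sp_imK mul1mx -mulmxA sp_kerK mulmx1 => ->.
(* Dually, the restriction of [y.1] to the kernel takes its values in the image. *)
have defy : y.1 *m sp_ker S1 = sp_im S1 *m (sp_imL S1 *m y.1 *m sp_ker S1).
  rewrite -[LHS]mul1mx -(sp_im_coker S1) mulmxDl -[_ *m _ *m (y.1 *m _)]mulmxA.
  by rewrite -(mulmxA (sp_cokerR S1)) (mulmxA (sp_coker S1)) y1 mulmx0 addr0 !mulmxA.
rewrite mulmxBr mulmxBl -!mulmxA kker_incl [in LHS]defy (mulmxA (e u)) kim_incl.
by rewrite !mulmxA sp_imK mul1mx.
Qed.

Lemma semistable_max_rank :
  semistable (kmod_of f) \/ semistable (kmod_of e) -> (0 < r1)%N || (0 < r2)%N ->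
  ext1_trivial (kmod_of f) (kmod_of e).
Proof.
move=> ss r_gt0; apply: contrapT => nontriv.
have KC := ext1_nontrivial_dim hom_kker_kcoker (fun t => nontriv (ext1_kker_kcoker t)).
have IC := ext1_trivial_dim ext1_kim_kcoker.
have KI := ext1_trivial_dim ext1_kker_kim.
have k1_gt0 : (0 < k1)%N by case: (posnP k1) KC => // ->; rewrite !muln0.
case: ss => [/semistable_kker_slope/(_ k1_gt0)|/semistable_kim_slope/(_ r_gt0)] le.
  move: (\dim {:U}) KC IC le r_gt0 k1_gt0 => d KC IC le r_gt0 k1_gt0.
  clear -KC IC le r_gt0 k1_gt0.
  have r1_gt0 : (0 < r1)%N by nia.
  (* [KC] times [r1] and [IC] times [k1] give [r1 * c2 * k2 < k1 * c2 * r2], against [le] times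
     [c2]. *)
  nia.
move: (\dim {:U}) KC KI le r_gt0 k1_gt0 => d KC KI le r_gt0 k1_gt0.
clear -KC KI le r_gt0 k1_gt0.
have c2_gt0 : (0 < c2)%N by case: (posnP c2) KC => // ->; rewrite !muln0.
have r2_gt0 : (0 < r2)%N.
  case: (posnP r2) r_gt0 le => // ->; rewrite orbF muln0 leqn0 muln_eq0 => r1_gt0.
  by rewrite !eqn0Ngt r1_gt0 c2_gt0.
(* [KC] times [r2] and [KI] times [c2] give [c1 * k1 * r2 < c2 * r1 * k1], against [le] times
   [k1]. *)
have := leq_mul KC (leqnn r2); have := leq_mul KI (leqnn c2).
have := leq_mul le (leqnn k1); nia.
Qed.

End KernelImageCokernel.

Lemma ex_max (T : Type) (P : T -> Prop) (m : T -> nat) (B : nat) :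
  (exists x, P x) -> (forall x, P x -> (m x <= B)%N) ->
  exists x, P x /\ forall y, P y -> (m y <= m x)%N.
Proof.
move=> [x Px] mB.
pose Q := [pred n | `[< exists x, P x /\ m x = n >]].
have exQ : exists n, Q n by exists (m x); apply/asboolP; exists x.
have QB n : Q n -> (n <= B)%N by move=> /asboolP [y [Py <-]]; apply: mB.
case: (ex_maxnP exQ QB) => n /asboolP [y [Py <-]] max.
by exists y; split=> // z Pz; apply: max; apply/asboolP; exists z.
Qed.

(** * Maximal pairs and first-order deformation *)

Section Generic.
Variables (F : fieldType) (U : vectType F) (b' a' b a : nat).
Hypothesis F_infinite : forall p : {poly F}, p != 0 -> exists t, p.[t] != 0.
Local Notation V := (krep U b' a' * krep U b a)%type.
Local Notation hompair := ('M[F]_(b, b') * 'M[F]_(a, a'))%type.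
Variable G : V -> Prop.
Hypothesis G_inhabited : exists v, G v.
Hypothesis G_lines : forall v w, G v -> almost_all (fun t => G (t *: w + v)).

Local Notation D v := (nablamx v.1 v.2).

(** The maximum is lexicographic. The second one runs over all points of maximal rank, not only over
    [v], because curves of homomorphisms move the modules too. *)
Definition maximal_pair (v : V) (x : hompair) :=
  [/\ G v, pack x *m D v = 0, forall w, G w -> (\rank (D w) <= \rank (D v))%N
    & forall w y, G w -> \rank (D w) = \rank (D v) -> pack y *m D w = 0 ->
        (\rank y.1 + \rank y.2 <= \rank x.1 + \rank x.2)%N].

Lemma maximal_pair_exists : exists v x, maximal_pair v x.
Proof.
have [v [Gv vmax]] :=
  ex_max (m := fun v => \rank (D v)) G_inhabited (fun v _ => rank_leq_row (D v)).
pose P (p : V * hompair) := [/\ G p.1, \rank (D p.1) = \rank (D v) & pack p.2 *m D p.1 = 0].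
have [||[w x] [[/= Gw rw xw] max]] :=
  @ex_max _ P (fun p => \rank p.2.1 + \rank p.2.2)%N (b + a).
- by exists (v, (0, 0)); split=> //=; rewrite /pack !linear0 row_mx0 mul0mx.
- by move=> p _; rewrite leq_add ?rank_leq_row.
exists w, x; split=> // [w' Gw'|w' y Gw' rw' yw']; first by rewrite rw vmax.
by apply: (max (w', y)); split=> //=; rewrite rw' rw.
Qed.

Definition line (v w : V) := affine (D v) (D w).

Lemma line_eval v w t : mxeval t (line v w) = D (t *: w + v).
Proof. by rewrite affine_eval addrC -nablamx_linear. Qed.

Lemma unpack_coef1 i (W : 'rV[{poly F}]_(b * b' + a * a')) :
  mxcoef i (unpack W).1 = (unpack (mxcoef i W)).1.
Proof. by rewrite /unpack /mxcoef /= map_vec_mx map_lsubmx. Qed.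

Lemma unpack_coef2 i (W : 'rV[{poly F}]_(b * b' + a * a')) :
  mxcoef i (unpack W).2 = (unpack (mxcoef i W)).2.
Proof. by rewrite /unpack /mxcoef /= map_vec_mx map_rsubmx. Qed.

Lemma unpack_eval t (W : 'rV[{poly F}]_(b * b' + a * a')) :
  unpack (mxeval t W) = (mxeval t (unpack W).1, mxeval t (unpack W).2).
Proof. by rewrite /unpack /mxeval /= !map_vec_mx map_lsubmx map_rsubmx. Qed.

Section Maximal.
Variables (v : V) (x : hompair).
Hypothesis maxvx : maximal_pair v x.

Lemma line_rank w : almost_all (fun t => \rank (mxeval t (line v w)) = \rank (D v)).
Proof.
have [Gv _ max _] := maxvx.
have [k [c [S]]] := splitting_exists (D v).
have := almost_allI (G_lines w Gv) (rank_lower_semicontinuous S (affine_coef0 _ (D w))).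
apply: almost_allW => t [Gt ge]; apply/eqP; rewrite eqn_leq ge andbT line_eval.
exact: max.
Qed.

Variables (k1 c1 k2 c2 : nat).
Variables (S1 : splitting (\rank x.1) k1 c1 x.1) (S2 : splitting (\rank x.2) k2 c2 x.2).

(** If one component of [y] failed to map kernel into image, [rank_growth] would raise the rank of
    that component along the curve while the other rank does not drop, against maximality. *)
Lemma hom_curve_kker w (W : 'rV[{poly F}]_(b * b' + a * a')) (y := unpack (mxcoef 1 W)) :
  mxcoef 0 W = pack x -> W *m line v w = 0 ->
  sp_coker S1 *m y.1 *m sp_ker S1 = 0 /\ sp_coker S2 *m y.2 *m sp_ker S2 = 0.
Proof.
move=> W0 WD; have [Gv _ _ max] := maxvx.
have X1 : mxcoef 0 (unpack W).1 = x.1 by rewrite unpack_coef1 W0 packK.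
have X2 : mxcoef 0 (unpack W).2 = x.2 by rewrite unpack_coef2 W0 packK.
have le : almost_all (fun t =>
    (\rank (mxeval t (unpack W).1) + \rank (mxeval t (unpack W).2)
      <= \rank x.1 + \rank x.2)%N).
  have := almost_allI (G_lines w Gv) (line_rank w); apply: almost_allW => t [Gt rt].
  have := max _ (mxeval t (unpack W).1, mxeval t (unpack W).2) Gt; apply.
    by rewrite -line_eval.
  rewrite -unpack_eval unpackK -line_eval -mxevalM WD.
  exact: map_mx0.
split; apply: contrapT => /eqP nz.
  have [] := almost_all_ex F_infinite (almost_allI le (almost_allI
    (rank_lower_semicontinuous S2 X2) (rank_growth (S := S1) X1 _))).
    by rewrite unpack_coef1.
  by move=> t; lia.
have [] := almost_all_ex F_infinite (almost_allI le (almost_allI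
  (rank_lower_semicontinuous S1 X1) (rank_growth (S := S2) X2 _))).
  by rewrite unpack_coef2.
by move=> t; lia.
Qed.

Lemma maximal_homs (psi : kpair (kmod_of v.1) (kmod_of v.2)) : is_khom psi ->
  sp_coker S1 *m psi.1 *m sp_ker S1 = 0 /\ sp_coker S2 *m psi.2 *m sp_ker S2 = 0.
Proof.
move=> /is_khomP hpsi; have [_ hx _ _] := maxvx.
(* The modules stay fixed, and the curve is the straight line from [x] in direction [psi] inside
   Hom. *)
pose W := affine (pack x) (pack psi).
have := @hom_curve_kker 0 W (affine_coef0 _ _); rewrite affine_coef1 packK; apply.
apply: (almost_all_mx_eq0 F_infinite); exists 1 => [|t _]; first exact: oner_neq0.
rewrite mxevalM line_eval affine_eval scaler0 add0r.
by rewrite mulmxDl -scalemxAl hx hpsi scaler0 addr0.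
Qed.

Lemma maximal_lift (d : 'Hom(U, 'M[F]_(a, b'))) :
  (forall u, sp_coker S2 *m d u *m sp_ker S1 = 0) ->
  exists y : kpair (kmod_of v.1) (kmod_of v.2),
    [/\ forall u, d u = v.2 u *m y.1 - y.2 *m v.1 u,
        sp_coker S1 *m y.1 *m sp_ker S1 = 0 & sp_coker S2 *m y.2 *m sp_ker S2 = 0].
Proof.
move=> d0; have [_ hx _ _] := maxvx.
(* The direction [w] is chosen so that [nabla w.1 w.2 x = d]. Varying the source module produces the
   part of [d] in the image; varying the target module produces the cokernel part, which vanishes on
   the kernel by [d0]. *)
pose w : V := (- sandwich (sp_coimR S2 *m sp_imL S2) d 1%:M,
  sandwich (sp_cokerR S2 *m sp_coker S2) d (sp_coimR S1 *m sp_imL S1)).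
have dE u : nabla w.1 w.2 x u = d u.
  rewrite nablaE /= opp_lfunE !sandwichE mulmx1 mulmxN opprK.
  rewrite -!mulmxA -sp_coimE !mulmxA -sp_imE addrC -[RHS]mul1mx -(sp_im_coker S2) mulmxDl.
  congr (_ + _); rewrite -[RHS]mulmx1 -(sp_coim_kerE S1) mulmxDr !mulmxA.
  rewrite -[X in _ + X *m _]mulmxA -[X in _ + X *m _]mulmxA (mulmxA (sp_coker S2)) d0.
  by rewrite mulmx0 mul0mx addr0.
have [k [c [S]]] := splitting_exists (D v).
have [|W W0 WD] := kernel_curve F_infinite S (affine_coef0 _ (D w)) _ hx.
  by apply: almost_allW (line_rank w) => t ->.
have [y1 y2] := hom_curve_kker W0 WD.
(* The linear coefficient of [W *m line v w = 0] says that [nabla] at [v] sends the derivative of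
   [W] to [- d]. *)
have := congr1 (mxcoef 1) WD; rewrite mxcoef1M W0 affine_coef0 affine_coef1.
rewrite -[mxcoef 1 W](@unpackK b' a' b a) => WD1.
exists (- (unpack (mxcoef 1 W)).1, - (unpack (mxcoef 1 W)).2).
split=> [u||] /=; rewrite ?mulmxN ?mulNmx ?y1 ?y2 ?oppr0 //.
have WD2 : pack x *m D w + pack (unpack (mxcoef 1 W)) *m D v = 0.
  by rewrite WD1; apply: map_mx0.
by rewrite -dE (nablamx_add_eq0 WD2) nablaE opprB opprK addrC.
Qed.

End Maximal.

Lemma generic_full_rank :
  (forall v : V, G v -> semistable (kmod_of v.1) \/ semistable (kmod_of v.2)) ->
  exists v : V, hom_trivial (kmod_of v.1) (kmod_of v.2) \/
    ext1_trivial (kmod_of v.1) (kmod_of v.2).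
Proof.
move=> Gss; have [v [x maxvx]] := maximal_pair_exists; exists v.
have [Gv hx _ max] := maxvx.
have [k1 [c1 [S1]]] := splitting_exists x.1.
have [k2 [c2 [S2]]] := splitting_exists x.2.
(* If the maximal rank sum is 0, every homomorphism at [v] is zero; otherwise [x] is a nonzero
   homomorphism. *)
have [/eqP|r_gt0] := posnP (\rank x.1 + \rank x.2).
  rewrite addn_eq0 => /andP[/eqP r1 /eqP r2]; left=> psi /is_khomP hpsi.
  have := max v psi Gv erefl hpsi; rewrite r1 r2 leqn0 addn_eq0 !mxrank_eq0.
  by case/andP => /eqP p1 /eqP p2; rewrite [psi]surjective_pairing p1 p2.
right; apply: (semistable_max_rank (phi := x) _ (S1 := S1) (S2 := S2)).
- exact/is_khomP.
- exact: maximal_homs.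
- exact: maximal_lift.
- exact: Gss.
by rewrite -addn_gt0.
Qed.

End Generic.

(** In characteristic 0 the naturals below [size p] are distinct, one too many to be all roots. *)
Lemma numField_nonroot (F : numFieldType) (p : {poly F}) : p != 0 -> exists t, p.[t] != 0.
Proof.
move=> p0; apply: contrapT => /forallNP p_root.
pose rs : seq F := [seq i%:R | i <- iota 0 (size p)].
have roots : all (root p) rs.
  by apply/allP => t _; apply/rootP/eqP; have /negP := p_root t; rewrite negbK.
have rs_uniq : uniq rs.
  by rewrite map_inj_uniq ?iota_uniq // => i j /eqP; rewrite eqr_nat => /eqP.
by have := max_poly_roots p0 roots rs_uniq; rewrite size_map size_iota ltnn.
Qed.

(** * Polynomial functions and dense open sets *)

Section Zariski.
Variables (F : fieldType) (V : vectType F).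

Definition polyfun (g : V -> F) := exists p, forall v, poly_eval p v = g v.

Lemma polyfun_const c : polyfun (fun=> c).
Proof. by exists (mpoly.mpolyC _ c) => v; rewrite /poly_eval mpoly.mevalC. Qed.

Lemma polyfunD g h : polyfun g -> polyfun h -> polyfun (fun v => g v + h v).
Proof.
move=> [p pE] [q qE]; exists (p + q) => v.
by rewrite -pE -qE /poly_eval mpoly.mevalD.
Qed.

Lemma polyfunM g h : polyfun g -> polyfun h -> polyfun (fun v => g v * h v).
Proof.
move=> [p pE] [q qE]; exists (p * q) => v.
by rewrite -pE -qE /poly_eval mpoly.mevalM.
Qed.

Lemma polyfun_ext g h : g =1 h -> polyfun g -> polyfun h.
Proof. by move=> gh [p pE]; exists p => v; rewrite pE gh. Qed.

Lemma polyfun_sum (I : Type) (r : seq I) (g : I -> V -> F) :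
  (forall i, polyfun (g i)) -> polyfun (fun v => \sum_(i <- r) g i v).
Proof.
move=> gP; elim: r => [|i r IH].
  by apply: polyfun_ext (polyfun_const 0) => v; rewrite big_nil.
by apply: polyfun_ext (polyfunD (gP i) IH) => v; rewrite big_cons.
Qed.

Lemma polyfun_prod (I : Type) (r : seq I) (g : I -> V -> F) :
  (forall i, polyfun (g i)) -> polyfun (fun v => \prod_(i <- r) g i v).
Proof.
move=> gP; elim: r => [|i r IH].
  by apply: polyfun_ext (polyfun_const 1) => v; rewrite big_nil.
by apply: polyfun_ext (polyfunM (gP i) IH) => v; rewrite big_cons.
Qed.

Lemma polyfun_linear (g : V -> F) :
  (forall c v w, g (c *: v + w) = c * g v + g w) -> polyfun g.
Proof.
move=> gL.
have g0 : g 0 = 0 by have := gL (-1) 0 0; rewrite scaler0 addr0 mulN1r addNr.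
have g_sum n (h : 'I_n -> F) (e : 'I_n -> V) : g (\sum_i h i *: e i) = \sum_i h i * g (e i).
  elim/big_rec2: _ => [//|i y z _ <-]; exact: gL.
apply: (@polyfun_ext (fun v => \sum_i coord (vbasis {:V}) i v * g (vbasis {:V})`_i)) => [v|].
  by rewrite -g_sum -coord_vbasis // memvf.
apply: polyfun_sum => i; apply: polyfunM; last exact: polyfun_const.
by exists (mpoly.mpolyX _ (mpoly.mnm1 i)) => v; rewrite /poly_eval mpoly.mevalXU.
Qed.

Lemma polyfun_det n (A : V -> 'M[F]_n) : (forall i j, polyfun (fun v => A v i j)) ->
  polyfun (fun v => \det (A v)).
Proof.
move=> AP; rewrite /determinant; apply: polyfun_sum => s.
by apply: polyfunM; [apply: polyfun_const | apply: polyfun_prod].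
Qed.

Lemma poly_eval_line (p : mpoly.mpoly (\dim {:V}) F) v w :
  exists q : {poly F}, forall t, q.[t] = poly_eval p (t *: w + v).
Proof.
exists (\sum_(m <- mpoly.msupp p) (mpoly.mcoeff m p)%:P *
  \prod_i ((coord (vbasis {:V}) i w)%:P * 'X + (coord (vbasis {:V}) i v)%:P)
    ^+ mpoly.fun_of_multinom m i) => t.
rewrite /poly_eval mpoly.mevalE horner_sum; apply: eq_bigr => m _.
rewrite hornerM hornerC horner_prod; congr (_ * _); apply: eq_bigr => i _.
by rewrite hornerE linearP /= !hornerE mulrC.
Qed.

Lemma zariski_open_lines (S : V -> Prop) v w : zariski_open S -> S v ->
  almost_all (fun t => S (t *: w + v)).
Proof.
move=> [E SE] /SE [p Ep pv]; have [q qE] := poly_eval_line p v w.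
exists q => [|t]; last by rewrite qE => ?; apply/SE; exists p.
by apply: (@poly_horner_neq0 _ _ 0); rewrite qE scale0r add0r.
Qed.

Lemma zariski_dense_inhabited (S : V -> Prop) : zariski_dense S -> exists v, S v.
Proof.
move=> dS; have [||v [_ Sv]] := dS (fun=> True); last by exists v.
  exists (fun p => p = 1) => v; split=> // _; exists 1 => //.
  by rewrite /poly_eval mpoly.meval1 oner_neq0.
by exists 0.
Qed.

Hypothesis F_infinite : forall p : {poly F}, p != 0 -> exists t, p.[t] != 0.

(** For density, take the line through a point [v] of [T] and a point [v0] with [g v0 != 0]: almost
    all of its points lie in both open sets. *)
Lemma holds_generally_principal (g : V -> F) (P : V -> Prop) : polyfun g ->
  (exists v, g v != 0) -> (forall v, g v != 0 -> P v) -> holds_generally P.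
Proof.
move=> [p pE] [v0 gv0] gP; exists (fun v => g v != 0).
have og : zariski_open (fun v => g v != 0).
  exists (fun q => q = p) => v; split=> [gv|[q ->]]; last by rewrite pE.
  by exists p; rewrite ?pE.
split=> // T oT [v Tv].
have T_line := zariski_open_lines (v0 - v) oT Tv.
have g_line : almost_all (fun t => g (t *: (v0 - v) + v) != 0).
  have [q qE] := poly_eval_line p v (v0 - v).
  exists q => [|t]; last by rewrite qE pE.
  by apply: (@poly_horner_neq0 _ _ 1); rewrite qE pE scale1r subrK.
have [t Tt] := almost_all_ex F_infinite (almost_allI T_line g_line).
by exists (t *: (v0 - v) + v).
Qed.

End Zariski.

(** * From one pair of full rank to general pairs *)

Section GenericRank.
Variables (F : fieldType) (U : vectType F) (b' a' b a : nat).
Hypothesis F_infinite : forall p : {poly F}, p != 0 -> exists t, p.[t] != 0.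
Local Notation V := (krep U b' a' * krep U b a)%type.

(** The compression of [nablamx] by a splitting at [v0] has determinant 1 there, and the rank is at
    least that at [v0] wherever this determinant is nonzero. *)
Lemma holds_generally_rank_ge (v0 : V) (P : V -> Prop) :
  (forall v : V, (\rank (nablamx v0.1 v0.2) <= \rank (nablamx v.1 v.2))%N -> P v) ->
  holds_generally P.
Proof.
move=> rP; have [k [c [S]]] := splitting_exists (nablamx v0.1 v0.2).
pose A v := sp_imL S *m nablamx v.1 v.2 *m sp_coimR S.
apply: (@holds_generally_principal _ _ F_infinite (fun v => \det (A v))).
- apply: polyfun_det => i j; apply: polyfun_linear => t v w.
  by rewrite /A nablamx_linear mulmxDr mulmxDl -scalemxAr -scalemxAl !mxE.
- by exists v0; rewrite /A sp_core det1 oner_neq0.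
by move=> v /unit_core_rank /rP.
Qed.

Lemma ext_unique (f : krep U b' a') (e : krep U b a) :
  hom_trivial (kmod_of f) (kmod_of e) \/ ext1_trivial (kmod_of f) (kmod_of e) ->
  forall i j, ext_nonzero i (kmod_of f) (kmod_of e) ->
    ext_nonzero j (kmod_of f) (kmod_of e) -> i = j.
Proof.
move=> triv [|i] [|j] //.
- by move=> /ext_nonzero0 nh /ext_nonzeroS [_ ne]; case: triv.
- by move=> /ext_nonzeroS [_ ne] /ext_nonzero0 nh; case: triv.
- by move=> /ext_nonzeroS [-> _] /ext_nonzeroS [-> _].
Qed.

Theorem generic_ext_unique :
  holds_generally (fun f : krep U b' a' => semistable (kmod_of f)) \/
    holds_generally (fun e : krep U b a => semistable (kmod_of e)) ->
  holds_generally (fun p : V => forall i j : nat,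
    ext_nonzero i (kmod_of p.1) (kmod_of p.2) ->
    ext_nonzero j (kmod_of p.1) (kmod_of p.2) -> i = j).
Proof.
move=> hss.
have [v0 triv0] : exists v : V, hom_trivial (kmod_of v.1) (kmod_of v.2) \/
    ext1_trivial (kmod_of v.1) (kmod_of v.2).
  case: hss => -[S [oS dS SP]]; have [s Ss] := zariski_dense_inhabited dS.
    apply: (@generic_full_rank _ _ _ _ _ _ F_infinite (fun v : V => S v.1)).
    - by exists (s, 0).
    - by move=> v w; apply: (zariski_open_lines w.1 oS).
    - by move=> v Sv; left; apply: SP.
  apply: (@generic_full_rank _ _ _ _ _ _ F_infinite (fun v : V => S v.2)).
  - by exists (0, s).
  - by move=> v w; apply: (zariski_open_lines w.2 oS).
  - by move=> v Sv; right; apply: SP.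
apply: (@holds_generally_rank_ge v0) => v le; apply: ext_unique.
case: triv0 => [/hom_trivialP|/ext1_trivialP] full; [left|right].
  by apply/hom_trivialP; rewrite /row_free eqn_leq rank_leq_row -{1}(eqP full).
by apply/ext1_trivialP; rewrite /row_full eqn_leq rank_leq_col -{1}(eqP full).
Qed.

End GenericRank.

Theorem theorem1p7 (R : realType) (N : nat) (hN : (3 <= N)%N)
    (U : vectType R[i]) (hU : \dim {:U} = N) (b' a' b a : nat)
    (hss : holds_generally (fun f : krep U b' a' => semistable (kmod_of f)) \/
           holds_generally (fun e : krep U b a => semistable (kmod_of e))) :
  holds_generally (fun p : (krep U b' a' * krep U b a)%type =>
    forall i j : nat,
      ext_nonzero i (kmod_of p.1) (kmod_of p.2) ->
      ext_nonzero j (kmod_of p.1) (kmod_of p.2) -> i = j).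
Proof.
exact: generic_ext_unique (@numField_nonroot _) hss.
Qed.
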